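(* Let $X$ be a real Banach space, let $\ell\geq 0$ and let $f: X \to \mathbb{R}\cup\{+\infty\}$ be a proper convex function which is $\ell$-Lipschitz on $\operatorname{dom}f$. Consider the function $\tilde{f}:X\to\mathbb{R}\cup\{+\infty\}$ given by $$\tilde{f}(x):=\sup\left\{\langle y^*,x-y\rangle+f(y)\,:\, y\in \operatorname{dom}f,\ y^*\in \partial f(y)\cap\ell\mathbb{B}^*\right\}, \quad \forall x\in X.$$ Then $\operatorname{dom}\tilde{f}=X$, $\tilde{f}$ is convex and $\ell$-Lipschitz on $X$, and for every $x\in\operatorname{dom}f$ $$\tilde{f}(x)=f(x), \quad \partial\tilde{f}(x)=\partial f(x)\cap\ell\mathbb{B}^*.$$
   Context: $X^*$ is the continuous dual of $X$ with its dual norm, $\mathbb{B}^*$ is the closed unit ball of $X^*$ (so $\ell\mathbb{B}^*=\{x^*\in X^*:\|x^*\|\le \ell\}$). For $f:X\to\mathbb{R}\cup\{+\infty\}$, $\operatorname{dom}f=\{x\in X: f(x)\in\mathbb{R}\}$; $f$ is proper if $\operatorname{dom} f\neq\emptyset$, and convex if its epigraph $\{(x,r)\in X\times\mathbb{R}: f(x)\le r\}$ is convex. $f$ is $\ell$-Lipschitz on a nonempty set $S\subset X$ if $f$ is finite on $S$ and $|f(x)-f(y)|\le \ell\|x-y\|$ for all $x,y\in S$. The subdifferential of $f$ at $x$ with $f(x)$ finite is $\partial f(x)=\{x^*\in X^*: f(y)-f(x)\ge\langle x^*,y-x\rangle\ \forall y\in X\}$. *)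

(* Defs.v *)
From mathcomp Require Export all_boot all_order all_algebra.
From mathcomp Require Export all_classical all_reals all_analysis.

Set Implicit Arguments.
Unset Strict Implicit.
Unset Printing Implicit Defensive.

Import Order.TTheory GRing.Theory Num.Theory.
Import numFieldNormedType.Exports.

Local Open Scope classical_set_scope.
Local Open Scope ring_scope.
Local Open Scope ereal_scope.

Section Defs.
Context {R : realType} {X : normedModType R}.
Implicit Types (f : X -> \bar R) (xs : {linear X -> R^o}).

Definition topological_dual : set {linear X -> R^o} :=
  [set xs | continuous (xs : X -> R^o)].

(* Extended-valued, so that it needs no boundedness proof: it is +oo exactly
   for the discontinuous functionals. *)
Definition dual_norm xs : \bar R :=
  ereal_sup [set (`|xs x|%R)%:E | x in [set x : X | (`|x| <= 1)%R]].

(* The ball of radius l; for l >= 0 this is l times the closed unit ball of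
   the dual. *)
Definition dual_ball (l : R) : set {linear X -> R^o} :=
  topological_dual `&` [set xs | dual_norm xs <= l%:E].

Definition dom f : set X := [set x | f x \is a fin_num].

Definition proper_fun f := dom f !=set0.

Definition epigraph f : set (X * R^o)%type := [set p | f p.1 <= p.2%:E].

Definition convex_efun f :=
  convex_set (epigraph f : set (convex_lmodType (X * R^o)%type)).

Definition elipschitz_on (l : R) (S : set X) f :=
  S `<=` dom f /\ l.-lipschitz_S (fine \o f : X -> R^o).

(* Only meaningful at points x with f x finite. *)
Definition subdifferential f (x : X) : set {linear X -> R^o} :=
  topological_dual `&` [set xs | forall y, (xs (y - x)%R)%:E <= f y - f x].

Definition lipschitz_extension (l : R) f (x : X) : \bar R :=
  ereal_sup [set z | exists y ys,
    [/\ dom f y, (subdifferential f y `&` dual_ball l) ys &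
        z = (ys (x - y)%R)%:E + f y]].

End Defs.

(* Main.v *)
Require Import Defs.
From HB Require Import structures.
From mathcomp Require Import ring lra.

Set Implicit Arguments.
Unset Strict Implicit.
Unset Printing Implicit Defensive.

Import Order.TTheory GRing.Theory Num.Theory.
Import numFieldNormedType.Exports.

Local Open Scope classical_set_scope.
Local Open Scope ring_scope.

(** The point is that a convex f which is l-Lipschitz on its domain has, at
    every x of the domain, a subgradient of norm at most l
    (lipschitz_subgradient_exists).  Consider the infimal convolution of f with
    l times the norm, recentred at x,

      p h = inf over y in dom f of f y - f x + l * |h - (y - x)|.

    It is convex, finite (the Lipschitz condition gives p h >= - l * |h|) and
    p 0 = 0, so a linear functional L lies below it by the Hahn-Banach theorem
    for convex functions (hahn_banach_convex).  Taking y = x gives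
    L h <= l * |h|; taking h = y - x gives L (y - x) <= f y - f x.

    Everything else follows formally.  The extension F is a supremum of
    l-Lipschitz affine functions, so it is convex and satisfies
    F x <= F y + l * |x - y|.  On dom f it is at most f by the subgradient
    inequality, and at least f because a subgradient at x exists; hence it is
    finite on dom f, and then everywhere.  A subgradient of F at x is bounded
    by l because F is l-Lipschitz on the whole space, and is a subgradient of
    f because F = f on dom f; conversely a subgradient of f of norm at most l
    is one of the slopes in the supremum defining F.

    The Hahn-Banach theorem is obtained by minimality rather than by extending
    partial functionals: by Zorn's lemma p dominates a minimal convex function
    vanishing at 0, and such a function is linear, since any deviation from
    linearity yields a smaller one. *)

(** * Hahn-Banach theorem for finite convex functions *)

Section RealConvex.
Context {R : realType} {V : lmodType R}.
Implicit Types (h p q : V -> R) (S : V -> set R).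

(** Jensen's inequality with two real weights: all the uses split 1 as a + b and
    need arithmetic on a and b, for which bundled interval weights are in the
    way. *)
Definition convex_rfun h := forall (a b : R) (x y : V),
  0 <= a -> 0 <= b -> a + b = 1 -> h (a *: x + b *: y) <= a * h x + b * h y.

(** The hypothesis says that the set of pairs (x, r) with r in S x is convex up
    to decreasing r; partial minimization of a convex set over the last
    coordinate is then convex.  The infimum of a chain, the directional
    perturbation of a minimal function and the infimal convolution are all of
    this form. *)
Lemma convex_inf_fibers S :
  (forall x, has_inf (S x)) ->
  (forall (a b : R) x y r s, 0 <= a -> 0 <= b -> a + b = 1 -> S x r -> S y s ->
    exists2 t, S (a *: x + b *: y) t & t <= a * r + b * s) ->
  convex_rfun (fun x => inf (S x)).
Proof.
move=> infS convS a b x y a0 b0 ab1; apply/ler_addgt0Pr => e e0.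
have [r Sr rx] := inf_adherent e0 (infS x).
have [s Ss sy] := inf_adherent e0 (infS y).
have [t St tle] := convS _ _ _ _ _ _ a0 b0 ab1 Sr Ss.
apply: (le_trans (ge_inf (infS _).2 St)); apply: (le_trans tle).
have := ler_wpM2l a0 (ltW rx); have := ler_wpM2l b0 (ltW sy).
rewrite !mulrDr => h1 h2; apply: (le_trans (lerD h2 h1)).
by rewrite addrACA -mulrDl ab1 mul1r.
Qed.

(** Convexity at the midpoint 0 of x and - x.  This is what bounds below all the
    convex functions lying under a given one. *)
Lemma convex_rfun_oppr h x : convex_rfun h -> h 0 = 0 -> - h (- x) <= h x.
Proof.
move=> hc h0; have := hc 2^-1 2^-1 x (- x).
rewrite -scalerDr subrr scaler0 h0 => H.
have : 0 <= 2^-1 * h x + 2^-1 * h (- x) by apply: H; lra.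
lra.
Qed.

Section Minimal.
Variable h : V -> R.
Hypotheses (h_convex : convex_rfun h) (h_zero : h 0 = 0).
Hypothesis h_min : forall q, convex_rfun q -> q 0 = 0 ->
  (forall x, q x <= h x) -> forall x, h x <= q x.

(** For 0 < t <= 1 the function y |-> h (t y) / t is again convex, vanishes at 0
    and is at most h, so by minimality it is h. *)
Lemma minimal_convex_homogeneous (s : R) x : 0 <= s -> h (s *: x) = s * h x.
Proof.
have le1 (t : R) y : 0 < t -> t <= 1 -> h (t *: y) = t * h y.
  move=> t0 t1; apply/eqP; rewrite eq_le; apply/andP; split.
    have := @h_convex t (1 - t) y 0; rewrite scaler0 addr0 h_zero mulr0 addr0.
    by apply; lra.
  rewrite mulrC -ler_pdivlMr//.
  apply: (@h_min (fun y => h (t *: y) / t)).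
  - move=> a b u v a0 b0 ab1; rewrite ler_pdivrMr// mulrDl.
    rewrite -!mulrA !mulVf ?gt_eqF// !mulr1 scalerDr !scalerA.
    rewrite (mulrC t a) (mulrC t b) -!scalerA; exact: h_convex.
  - by rewrite scaler0 h_zero mul0r.
  - move=> u; rewrite ler_pdivrMr// mulrC.
    have := @h_convex t (1 - t) u 0; rewrite scaler0 addr0 h_zero mulr0 addr0.
    by apply; lra.
rewrite le_eqVlt => /predU1P[<-|s0]; first by rewrite scale0r h_zero mul0r.
(* a factor s > 1 is undone by the factor s^-1 <= 1 applied at s x *)
have [s1|s1] := leP s 1; first exact: le1.
have sV0 : 0 < s^-1 by rewrite invr_gt0.
have := le1 s^-1 (s *: x) sV0.
rewrite scalerA mulVf ?gt_eqF// scale1r => ->; last by rewrite invf_le1// ltW.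
by rewrite mulrA mulfV ?mul1r// gt_eqF.
Qed.

Lemma minimal_convex_subadditive x y : h (x + y) <= h x + h y.
Proof.
have := @h_convex 2^-1 2^-1 x y.
rewrite -scalerDr minimal_convex_homogeneous; last lra.
move=> hxy; have : 2^-1 * h (x + y) <= 2^-1 * h x + 2^-1 * h y.
  by apply: hxy; lra.
lra.
Qed.

(** The function x |-> inf over t >= 0 of h (x + t a) - t h a is convex and at
    most h (take t = 0), and vanishes at 0 by homogeneity; by minimality it is
    h, and the term t = 1 of the infimum is the claim. *)
Lemma minimal_convex_superadditive x a : h x + h a <= h (x + a).
Proof.
pose S x := [set r | exists2 t, 0 <= t & r = h (x + t *: a) - t * h a].
have S_lb u : lbound (S u) (- h (- u)).
  move=> _ [t t0 ->]; rewrite -minimal_convex_homogeneous//.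
  have := minimal_convex_subadditive (u + t *: a) (- u).
  rewrite addrAC subrr add0r; lra.
have S_inf u : has_inf (S u).
  split; last by exists (- h (- u)); exact: S_lb.
  by exists (h (u + 0 *: a) - 0 * h a); exists 0.
have h_le : h x <= inf (S x).
  apply: (@h_min (fun x => inf (S x))).
  - apply: convex_inf_fibers => // c d u v _ _ c0 d0 cd1 [t t0 ->] [s s0 ->].
    exists (h (c *: u + d *: v + (c * t + d * s) *: a) - (c * t + d * s) * h a).
      by exists (c * t + d * s) => //; rewrite addr_ge0 ?mulr_ge0.
    have := @h_convex c d (u + t *: a) (v + s *: a) c0 d0 cd1.
    rewrite !scalerDr addrACA !scalerA -scalerDl; lra.
  - suff -> : S 0 = [set 0] by rewrite inf1.
    apply/seteqP; split=> [_ [t t0 ->]|_ ->] /=.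
      by rewrite add0r minimal_convex_homogeneous// subrr.
    by exists 0 => //; rewrite scale0r addr0 h_zero mul0r subr0.
  - move=> u; apply: ge_inf; first by have [] := S_inf u.
    by exists 0 => //; rewrite scale0r addr0 mul0r subr0.
rewrite -lerBrDr; apply: (le_trans h_le); apply: ge_inf.
  by have [] := S_inf x.
by exists 1 => //; rewrite scale1r mul1r.
Qed.

Lemma minimal_convex_linear : linear (h : V -> R^o).
Proof.
have hD x y : h (x + y) = h x + h y.
  apply/eqP; rewrite eq_le minimal_convex_subadditive.
  exact: minimal_convex_superadditive.
have hN x : h (- x) = - h x.
  by apply/eqP; rewrite -addr_eq0 -hD addNr h_zero.
move=> c x y; rewrite hD; congr (_ + _).
have [c0|c0] := leP 0 c; first exact: minimal_convex_homogeneous.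
rewrite -[c]opprK scaleNr hN minimal_convex_homogeneous ?oppr_ge0 ?ltW//.
by rewrite scaleNr.
Qed.

End Minimal.

(** Zorn's lemma for the reverse pointwise order: the pointwise infimum of a
    chain of convex functions is convex, and it is finite because every member
    is at least - p (- x) at x. *)
Lemma minimal_convex_exists p : convex_rfun p -> p 0 = 0 ->
  exists h, [/\ convex_rfun h, h 0 = 0, forall x, h x <= p x &
    forall q, convex_rfun q -> q 0 = 0 -> (forall x, q x <= h x) ->
      forall x, h x <= q x].
Proof.
move=> pc p0.
pose P q := [/\ convex_rfun q, q 0 = 0 & forall x, q x <= p x].
have Pp : P p by split.
pose T := {q | P q}.
pose Rge (q q' : T) := `[< forall x, sval q' x <= sval q x >].
have [||A totA|[h [hc h0 hp]] hmin] := @ZL_preorder T (exist _ p Pp) Rge.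
- by move=> q; apply/asboolP.
- move=> q r s /asboolP qr /asboolP rs; apply/asboolP => x.
  by apply: (le_trans (rs x)); exact: qr.
(* the empty chain is bounded by p itself *)
- have [[q0 Aq0]|A0] := pselect (A !=set0); last first.
    by exists (exist _ p Pp) => s As; case: A0; exists s.
  pose S x := [set sval q x | q in A].
  have S_inf x : has_inf (S x).
    split; first by exists (sval q0 x); exists q0.
    exists (- p (- x)) => _ [[q [qc qz qp]] Aq <-] /=.
    by rewrite (le_trans _ (convex_rfun_oppr x qc qz))// lerN2.
  have PS : P (fun x => inf (S x)).
    split.
    + apply: convex_inf_fibers => // a b x y _ _ a0 b0 ab1 [q Aq <-] [r Ar <-].
      have [/asboolP le|/asboolP le] := totA _ _ Aq Ar.
      * exists (sval r (a *: x + b *: y)); first by exists r.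
        have [rc _ _] := svalP r; apply: (le_trans (rc _ _ _ _ a0 b0 ab1)).
        by rewrite lerD2r ler_wpM2l.
      * exists (sval q (a *: x + b *: y)); first by exists q.
        have [qc _ _] := svalP q; apply: (le_trans (qc _ _ _ _ a0 b0 ab1)).
        by rewrite lerD2l ler_wpM2l.
    + suff -> : S 0 = [set 0] by rewrite inf1.
      apply/seteqP; split=> [_ [[q [_ q00 _]] _ <-]//|_ ->].
      by exists q0 => //; have [] := svalP q0.
    + move=> x; apply: le_trans (ge_inf (S_inf x).2 _) _; first by exists q0.
      by have [] := svalP q0.
  exists (exist _ _ PS) => s As; apply/asboolP => x /=.
  by apply: (ge_inf (S_inf x).2); exists s.
- exists h; split=> // q qc qz qh x.
  have Pq : P q by split=> // y; exact: le_trans (qh y) (hp y).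
  have /asboolP := hmin (exist _ q Pq) (introT (asboolP _) qh).
  by apply.
Qed.

Theorem hahn_banach_convex p : convex_rfun p -> p 0 = 0 ->
  exists L : {linear V -> R^o}, forall x, L x <= p x.
Proof.
move=> pc p0; have [h [hc h0 hp hmin]] := minimal_convex_exists pc p0.
have hlin := minimal_convex_linear hc h0 hmin.
pose L : {linear V -> R^o} :=
  HB.pack h (GRing.isLinear.Build R V R^o *:%R h hlin).
by exists L.
Qed.

End RealConvex.

(** * Subgradients of norm at most l *)

Section LipschitzExtension.
Context {R : realType} {X : normedModType R}.
Variable l : R.
Hypothesis l_ge0 : 0 <= l.
Implicit Types (f : X -> \bar R) (xs : {linear X -> R^o}) (x y : X).

(** One inequality without absolute value suffices, by linearity applied to
    - x; it also implies continuity. *)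
Lemma dual_ballP xs : dual_ball l xs <-> forall x, xs x <= l * `|x|.
Proof.
split=> [[_ xsl] x|xsl].
  have [->|x0] := eqVneq x 0; first by rewrite linear0 normr0 mulr0.
  have nx : 0 < `|x| by rewrite normr_gt0.
  have : `|xs (`|x|^-1 *: x)| <= l.
    rewrite -lee_fin; apply: le_trans xsl; apply: ereal_sup_ubound.
    exists (`|x|^-1 *: x) => //=.
    by rewrite normrZ normfV normr_id mulVf ?gt_eqF.
  rewrite linearZ/= normrZ normfV normr_id mulrC ler_pdivrMr//.
  exact/le_trans/ler_norm.
have xs_norm x : `|xs x| <= l * `|x|.
  by rewrite ler_norml xsl lerNl -linearN -normrN xsl.
split.
  apply: bounded_linear_continuous; apply/linear_boundedP.
  near=> r => x; apply: (le_trans (xs_norm x)); apply: ler_wpM2r => //.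
apply: ge_ereal_sup => _ [x /= x1 <-]; rewrite lee_fin.
by apply: (le_trans (xs_norm x)); rewrite ler_piMr.
Unshelve. all: by end_near. Qed.

(** Membership of xs in the set of slopes of the extension, in terms of real
    numbers only.  Points outside dom f impose no condition because f is +oo
    there. *)
Lemma lipschitz_subgradientP f x xs :
  (forall y, f y <> -oo%E) -> dom f x ->
  (subdifferential f x `&` dual_ball l) xs <->
  (forall y, xs y <= l * `|y|) /\
  (forall y, dom f y -> xs (y - x) <= fine (f y) - fine (f x)).
Proof.
move=> f_gtNy fx; split=> [[[_ sub] /dual_ballP ball]|[ball sub]].
  split=> // y fy; rewrite -lee_fin EFinB !fineK//; exact: sub.
have /dual_ballP xsB := ball.
split=> //; split=> [|y]; first by have [] := xsB.
move: (sub y); rewrite /dom/= -{2}(fineK fx).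
case: (f y) (f_gtNy y) => [r||]// _ H.
  by rewrite -EFinB lee_fin; exact: H.
by rewrite /= leey.
Qed.

Lemma convex_efun_dom f x y (a b : R) : (forall y, f y <> -oo%E) ->
  convex_efun f -> 0 <= a -> 0 <= b -> a + b = 1 -> dom f x -> dom f y ->
  dom f (a *: x + b *: y) /\
  fine (f (a *: x + b *: y)) <= a * fine (f x) + b * fine (f y).
Proof.
move=> f_gtNy fc a0 b0 ab1 fx fy.
have a1 : a <= 1 by lra.
have bE : b = 1 - a by lra.
have : epigraph f (a *: x + b *: y, a * fine (f x) + b * fine (f y)).
  have := fc (x, fine (f x)) (y, fine (f y)) (Itv01 a0 a1).
  rewrite !inE /epigraph/= !fineK// bE; exact.
rewrite /epigraph/= /dom/=; move: (f_gtNy (a *: x + b *: y)).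
by case: (f (a *: x + b *: y)) => [r _||]//=; rewrite lee_fin.
Qed.

(** Hahn-Banach applied to the infimal convolution of f with l times the norm,
    recentred at x; see the introduction. *)
Lemma lipschitz_subgradient_exists f x :
  (forall y, f y <> -oo%E) -> convex_efun f -> elipschitz_on l (dom f) f ->
  dom f x -> exists xs, (subdifferential f x `&` dual_ball l) xs.
Proof.
move=> f_gtNy fc [_ flip] fx.
have f_lip u v : dom f u -> dom f v -> fine (f u) - fine (f v) <= l * `|u - v|.
  move=> fu fv; apply: (le_trans (ler_norm _)).
  exact: (flip (u, v)).
pose S u := [set fine (f y) - fine (f x) + l * `|u - (y - x)| | y in dom f].
have S_lb u : lbound (S u) (- (l * `|u|)).
  move=> _ [y fy <-]; have := f_lip _ _ fx fy.
  have : l * `|x - y| <= l * (`|u| + `|u - (y - x)|).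
    apply: ler_wpM2l => //; rewrite -[x - y](addKr u) opprB.
    by apply: le_trans (ler_normD _ _) _; rewrite normrN.
  rewrite mulrDr; lra.
have S_inf u : has_inf (S u).
  split; last by exists (- (l * `|u|)); exact: S_lb.
  by eexists; exists x.
have [||L Lp] := @hahn_banach_convex _ _ (fun u => inf (S u)).
- apply: convex_inf_fibers => // a b u v _ _ a0 b0 ab1 [y fy <-] [z fz <-].
  have [fyz le_yz] := convex_efun_dom f_gtNy fc a0 b0 ab1 fy fz.
  eexists; first by exists (a *: y + b *: z).
  have -> : a *: u + b *: v - (a *: y + b *: z - x) =
      a *: (u - (y - x)) + b *: (v - (z - x)).
    rewrite -{1}(scale1r x) -ab1 scalerDl !scalerBr.
    rewrite -[RHS]addrACA; congr (_ + _); rewrite -opprD; congr (- _).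
    by rewrite addrACA opprD.
  have : l * `|a *: (u - (y - x)) + b *: (v - (z - x))| <=
      l * (a * `|u - (y - x)| + b * `|v - (z - x)|).
    apply: ler_wpM2l => //; apply: le_trans (ler_normD _ _) _.
    by rewrite !normrZ !ger0_norm.
  have : fine (f x) = a * fine (f x) + b * fine (f x).
    by rewrite -mulrDl ab1 mul1r.
  lra.
- apply/eqP; rewrite eq_le; apply/andP; split.
    apply: (ge_inf (S_inf 0).2); exists x => //.
    by rewrite !subrr normr0 mulr0 addr0.
  apply: lb_le_inf; first by have [] := S_inf 0.
  by have := S_lb 0; rewrite normr0 mulr0 oppr0.
exists L; apply/lipschitz_subgradientP => //.
split=> [u|y fy]; apply: (le_trans (Lp _)); apply: (ge_inf (S_inf _).2).
- by exists x => //; rewrite !subrr subr0 add0r.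
- by exists y => //; rewrite subrr normr0 mulr0 addr0.
Qed.

(** * The Lipschitz extension *)

Section Extension.
Variable f : X -> \bar R.
Hypotheses (f_gtNy : forall x, f x <> -oo%E) (f_proper : proper_fun f).
Hypotheses (f_convex : convex_efun f) (f_lipschitz : elipschitz_on l (dom f) f).

Let F := lipschitz_extension l f.

Lemma lipschitz_extension_ge x y ys :
  dom f y -> (subdifferential f y `&` dual_ball l) ys ->
  ((ys (x - y) + fine (f y))%:E <= F x)%E.
Proof.
move=> fy sub; apply: ereal_sup_ubound; exists y, ys; split=> //.
by rewrite EFinD fineK.
Qed.

Lemma lipschitz_extension_le x (r : R) :
  (forall y ys, dom f y -> (subdifferential f y `&` dual_ball l) ys ->
    ys (x - y) + fine (f y) <= r) -> (F x <= r%:E)%E.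
Proof.
move=> le_r; apply: ge_ereal_sup => _ [y [ys [fy sub ->]]].
by rewrite -(fineK fy) -EFinD lee_fin; exact: le_r.
Qed.

(** The bound from above is the subgradient inequality; the bound from below is
    the existence of a bounded subgradient at x itself. *)
Lemma lipschitz_extension_eq x : dom f x -> F x = f x.
Proof.
move=> fx; rewrite -(fineK fx); apply/eqP; rewrite eq_le; apply/andP; split.
  apply: lipschitz_extension_le => y ys fy /lipschitz_subgradientP[]// _ sub.
  by rewrite -lerBrDr; exact: sub.
have [xs sub] := lipschitz_subgradient_exists f_gtNy f_convex f_lipschitz fx.
by have := lipschitz_extension_ge x fx sub; rewrite subrr linear0 add0r.
Qed.

(** The Lipschitz estimate in a form that makes sense before F is known to be
    finite; finiteness of F is then deduced from it. *)
Lemma lipschitz_extension_growth x y (r : R) :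
  (F y <= r%:E)%E -> (F x <= (r + l * `|x - y|)%:E)%E.
Proof.
move=> Fy; apply: lipschitz_extension_le => z zs fz sub.
have := le_trans (lipschitz_extension_ge y fz sub) Fy; rewrite lee_fin.
have [ball _] := (lipschitz_subgradientP zs f_gtNy fz).1 sub.
have -> : x - z = (x - y) + (y - z) by rewrite addrA subrK.
rewrite linearD/=; have := ball (x - y); lra.
Qed.

Lemma dom_lipschitz_extension : dom F = setT.
Proof.
apply/seteqP; split=> // x _; have [y fy] := f_proper.
have [ys sub] := lipschitz_subgradient_exists f_gtNy f_convex f_lipschitz fy.
have := lipschitz_extension_ge x fy sub.
have : (F y <= (fine (f y))%:E)%E by rewrite lipschitz_extension_eq// fineK.
move=> /(lipschitz_extension_growth x).
by rewrite /dom/= ; case: (F x) => [r||].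
Qed.

Lemma convex_lipschitz_extension : convex_efun F.
Proof.
move=> [x r] [y s] t; rewrite !inE /epigraph/= => Fx Fy.
apply: lipschitz_extension_le => z zs fz sub.
have := le_trans (lipschitz_extension_ge x fz sub) Fx; rewrite lee_fin => Hx.
have := le_trans (lipschitz_extension_ge y fz sub) Fy; rewrite lee_fin => Hy.
have a0 : 0 <= t%:num by [].
have a1 : 0 <= 1 - t%:num by rewrite subr_ge0.
rewrite /unstable.onem; move: (t%:num) a0 a1 => a a0 a1.
have -> : a *: x + (1 - a) *: y - z = a *: (x - z) + (1 - a) *: (y - z).
  rewrite !scalerBr addrACA; congr (_ + _).
  by rewrite -opprD -scalerDl addrC subrK scale1r.
rewrite linearD !linearZ/=.
have := ler_wpM2l a0 Hx; have := ler_wpM2l a1 Hy.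
rewrite /GRing.scale/=; lra.
Qed.

Lemma elipschitz_lipschitz_extension : elipschitz_on l setT F.
Proof.
have domF x : dom F x by rewrite dom_lipschitz_extension.
have le_F x y : fine (F x) <= fine (F y) + l * `|x - y|.
  rewrite -lee_fin fineK; last exact: domF.
  by apply: lipschitz_extension_growth; rewrite fineK//; exact: domF.
split=> [x _|[x y] _ /=]; first exact: domF.
by rewrite ler_distl lerBlDr le_F andbT distrC le_F.
Qed.

Lemma subdifferential_lipschitz_extension x : dom f x ->
  subdifferential F x = subdifferential f x `&` dual_ball l.
Proof.
move=> fx; have domF y : dom F y by rewrite dom_lipschitz_extension.
have F_gtNy y : F y <> -oo%E by move: (domF y); rewrite /dom/=; case: (F y).
have [_ F_lip] := elipschitz_lipschitz_extension.
have Ffx := lipschitz_extension_eq fx.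
apply/seteqP; split=> [xs [xs_cont sub]|xs sub].
  have sub' y : xs (y - x) <= fine (F y) - fine (F x).
    by rewrite -lee_fin EFinB !fineK; [exact: sub|exact: domF..].
  apply/lipschitz_subgradientP => //; split=> y; last first.
    by move=> fy; have := sub' y; rewrite Ffx lipschitz_extension_eq.
  (* the Lipschitz bound for F between y + x and x bounds the slope at y *)
  have := sub' (y + x); rewrite addrK => /le_trans; apply.
  apply: le_trans (ler_norm _) _; have := F_lip (y + x, x).
  by rewrite /= addrK; exact.
suff [] : (subdifferential F x `&` dual_ball l) xs by [].
have [ball _] := (lipschitz_subgradientP xs f_gtNy fx).1 sub.
apply/lipschitz_subgradientP => //; split=> // y _.
rewrite Ffx lerBrDr -lee_fin (fineK (domF y)).
exact: lipschitz_extension_ge.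
Qed.

End Extension.
End LipschitzExtension.

Theorem theorem5p1 (R : realType) (X : completeNormedModType R)
    (l : R) (l_ge0 : 0 <= l)
    (f : X -> \bar R) (f_gtNy : forall x : X, f x <> -oo%E)
    (f_proper : proper_fun f) (f_convex : convex_efun f)
    (f_lipschitz : elipschitz_on l (dom f) f) :
  [/\ dom (lipschitz_extension l f) = setT,
      convex_efun (lipschitz_extension l f),
      elipschitz_on l setT (lipschitz_extension l f) &
      forall x : X, dom f x ->
        lipschitz_extension l f x = f x /\
        subdifferential (lipschitz_extension l f) x =
          subdifferential f x `&` dual_ball l].
Proof.
split.
- exact: dom_lipschitz_extension.
- exact: convex_lipschitz_extension.
- exact: elipschitz_lipschitz_extension.
- move=> x fx; split; first exact: lipschitz_extension_eq.
  exact: subdifferential_lipschitz_extension.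
Qed.
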